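(* Fix $\lambda\in(0,\infty)$ and positive integers $n,m$. Let $\mathfrak{P}\subseteq\{1,\dots,n\}\times\{1,\dots,m\}$ be a pattern, and let $\mathcal{M}_{\mathfrak{P}}$ be the set of non-negative $n\times m$ matrices $M$ with $M_{ij}>0$ if and only if $(i,j)\in\mathfrak{P}$, having no zero row and no zero column (identified with the open set $(0,\infty)^{\mathfrak{P}}$). Let $\mathfrak{D}\subseteq(0,\infty)^n\times(0,\infty)^m$ be the set of pairs $(\mathbf{r},\mathbf{c})$ for which the pattern $\mathfrak{P}$ is exactly $(\mathbf{r},\mathbf{c})$-scalable. Define $\Phi:\mathcal{M}_{\mathfrak{P}}\times\mathfrak{D}\to\mathcal{M}_{\mathfrak{P}}$ by letting $\Phi(M,\mathbf{r},\mathbf{c})$ be the limit of $(\mathbf{r},\mathbf{c})$-Sinkhorn scaling applied to $M^{[\lambda]}$. Then $\Phi$ is smooth.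
   Context: $M^{[\lambda]}$ denotes the matrix with entries $(M_{ij})^{\lambda}$ (zero where $M_{ij}=0$). $(\mathbf{r},\mathbf{c})$-Sinkhorn scaling of a non-negative matrix $A$ is the iterated alternation of rescaling each row $i$ so that its sum equals $r_i$ and rescaling each column $j$ so that its sum equals $c_j$. The pattern $\mathfrak{P}$ is exactly $(\mathbf{r},\mathbf{c})$-scalable if there exists a matrix of pattern $\mathfrak{P}$ (positive exactly on $\mathfrak{P}$) with row sums $\mathbf{r}$ and column sums $\mathbf{c}$; equivalently (Rothblum–Schneider), every $M\in\mathcal{M}_{\mathfrak{P}}$ admits positive diagonal matrices $D_1,D_2$ with $D_1MD_2$ having row sums $\mathbf{r}$ and column sums $\mathbf{c}$; equivalently, $\sum_i r_i=\sum_j c_j$ and for all $I\subseteq\{1,\dots,n\}$, $J\subseteq\{1,\dots,m\}$ with $I^c\times J$ disjoint from $\mathfrak{P}$ one has $\sum_{i\in I}r_i\ge\sum_{j\in J}c_j$, with equality if and only if $I\times J^c$ is disjoint from $\mathfrak{P}$. In this case the Sinkhorn limit is $D_1M^{[\lambda]}D_2$ with these marginals. *)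

(* Defs.v *)
From HB Require Import structures.
From mathcomp Require Import all_boot all_order all_algebra.
From mathcomp Require Import all_classical all_reals all_analysis.
Set Implicit Arguments. Unset Strict Implicit. Unset Printing Implicit Defensive.
Import Order.TTheory GRing.Theory Num.Theory.
Import numFieldNormedType.Exports.
Local Open Scope classical_set_scope.
Local Open Scope ring_scope.

Section Defs.
Variable R : realType.

Definition mx_pow n m (lambda : R) (M : 'M[R]_(n, m)) : 'M[R]_(n, m) :=
  \matrix_(i, j) (if M i j == 0 then 0 else M i j `^ lambda).

Definition pattern_mx n m (P : {set 'I_n * 'I_m}) : set 'M[R]_(n, m) :=
  [set M : 'M[R]_(n, m) | (forall i j, 0 <= M i j) /\
           (forall i j, (0 < M i j) <-> ((i, j) \in P)) /\
           (forall i, exists j, M i j != 0) /\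
           (forall j, exists i, M i j != 0)].

Definition exactly_scalable n m (P : {set 'I_n * 'I_m})
    (r : 'rV[R]_n) (c : 'rV[R]_m) : Prop :=
  exists X : 'M[R]_(n, m),
    (forall i j, 0 <= X i j) /\
    (forall i j, (0 < X i j) <-> ((i, j) \in P)) /\
    (forall i, \sum_(j < m) X i j = r 0 i) /\
    (forall j, \sum_(i < n) X i j = c 0 j).

Definition scalable_marginals n m (P : {set 'I_n * 'I_m})
    : set ('rV[R]_n * 'rV[R]_m) :=
  [set rc : 'rV[R]_n * 'rV[R]_m | (forall i, 0 < rc.1 0 i) /\ (forall j, 0 < rc.2 0 j) /\
            exactly_scalable P rc.1 rc.2].

Definition row_normalize n m (r : 'rV[R]_n) (A : 'M[R]_(n, m)) : 'M[R]_(n, m) :=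
  \matrix_(i, j) (A i j * r 0 i / \sum_(k < m) A i k).

Definition col_normalize n m (c : 'rV[R]_m) (A : 'M[R]_(n, m)) : 'M[R]_(n, m) :=
  \matrix_(i, j) (A i j * c 0 j / \sum_(k < n) A k j).

Fixpoint sinkhorn_iter n m (r : 'rV[R]_n) (c : 'rV[R]_m) (A : 'M[R]_(n, m))
    (k : nat) : 'M[R]_(n, m) :=
  match k with
  | 0%N => A
  | k'.+1 => if odd k' then col_normalize c (sinkhorn_iter r c A k')
             else row_normalize r (sinkhorn_iter r c A k')
  end.

Definition sinkhorn_limit n m (lambda : R)
    (x : 'M[R]_(n, m) * 'rV[R]_n * 'rV[R]_m) : 'M[R]_(n, m) :=
  lim (sinkhorn_iter x.1.2 x.2 (mx_pow lambda x.1.1) @ \oo).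

Fixpoint iter_dderiv (V W : normedModType R) (vs : seq V) (f : V -> W) : V -> W :=
  match vs with
  | [::] => f
  | v :: vs' => fun x => 'D_v (iter_dderiv vs' f) x
  end.

Definition Cinf_on (V W : normedModType R) (U : set V) (f : V -> W) : Prop :=
  forall (vs : seq V) (x : V), U x ->
    {for x, continuous (iter_dderiv vs f)} /\
    (forall v, derivable (iter_dderiv vs f) x v).

(** Smoothness of f on an arbitrary subset S (Milnor's definition): locally
    near each point of S, f agrees on S with a C^oo map on an open set. *)
Definition smooth_on (V W : normedModType R) (S : set V) (f : V -> W) : Prop :=
  forall x, S x -> exists U : set V, [/\ open U, U x &
    exists F : V -> W, Cinf_on U F /\ (forall y, U y -> S y -> F y = f y)].

End Defs.

(* Main.v *)
(** A scaling of the matrix A = M^[lambda] has entries A_e exp(t_e), e in P, where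
    t runs through the row space of the incidence matrix E of the pattern.
    Writing t = z B with B a basis of that row space, the marginal conditions
    become sum_e A_e exp((z B)_e) B_le = beta_l, the critical equation of a
    strictly convex function of z; it is coercive as soon as beta is the moment
    vector of some positive matrix of the pattern, an open condition on beta.
    So z is defined, by minimization, in a full neighbourhood of a point of the
    domain, including marginals that are not scalable.

    The difference of two critical equations is linear in the increment of z,
    with the symmetric matrix H = B diag(d) B^T, d > 0: pairing it with the
    increment gives continuity of z, and dividing by a step gives its directional
    derivatives by Cramer's rule.  Hence A_e, 1/M_e, beta_l, exp(t_e) and
    1/det H generate an algebra of functions stable under directional
    derivatives, so all its members are C^oo.

    Finally, if X = D1 A D2 has the required marginals, the Sinkhorn iterates are
    X_ij y_j / w_i with w and y obtained alternately as weighted arithmetic and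
    harmonic means; sum_j c_j y_j^2 decreases by at least
    sum_ij X_ij (y_j - w_i)^2 per round, so y_j - w_i -> 0 on the pattern and the
    iterates tend to X. *)
Require Import Defs.
From HB Require Import structures.
From mathcomp Require Import all_boot all_order all_algebra.
From mathcomp Require Import all_classical all_reals all_analysis.
From mathcomp Require Import zify ring lra.
Import Order.TTheory GRing.Theory Num.Theory.
Import numFieldNormedType.Exports.
Local Open Scope classical_set_scope.
Local Open Scope ring_scope.
Set Implicit Arguments.
Unset Strict Implicit.
Unset Printing Implicit Defensive.

(** * Algebras of functions stable under directional derivatives *)

Lemma cvg_mxP (R : realType) (T : Type) (F : set_system T) p q
    (f : T -> 'M[R]_(p, q)) (l : 'M[R]_(p, q)) :
  Filter F -> (forall i j, f x i j @[x --> F] --> l i j) <->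
              (f x @[x --> F] --> l).
Proof.
move=> FF; split=> [fl|fl i j].
- apply/cvgrPdist_le => /= e e0; near=> x.
  rewrite /Num.Def.normr/= mx_normrE (bigmax_le _ (ltW e0))//= => i _.
  rewrite !mxE; move: i; near: x; apply: filter_forall => /= i.
  by move/cvgrPdist_le : (fl i.1 i.2) => /(_ _ e0).
- apply: (@cvg_comp _ _ _ f (fun M : 'M[R]_(p, q) => M i j) _ _ _ fl).
  exact: coord_continuous.
Unshelve. all: by end_near. Qed.

Lemma cvg_det (R : realType) (T : Type) (F : set_system T) k
    (f : T -> 'M[R]_k) (l : 'M[R]_k) :
  Filter F -> (forall i j, f x i j @[x --> F] --> l i j) ->
  \det (f x) @[x --> F] --> \det l.
Proof.
move=> FF fl; rewrite /determinant; apply: cvg_big => [|s _]; first exact: add_continuous.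
apply: cvgM; first exact: cvg_cst.
by apply: cvg_big => [|i _]; [exact: mul_continuous | exact: fl].
Qed.

Lemma cvg_adj (R : realType) (T : Type) (F : set_system T) k
    (f : T -> 'M[R]_k) (l : 'M[R]_k) :
  Filter F -> (forall i j, f x i j @[x --> F] --> l i j) ->
  forall i j, (\adj (f x)) i j @[x --> F] --> (\adj l) i j.
Proof.
move=> FF fl i j; rewrite mxE; under eq_fun do rewrite mxE.
apply: cvgM; first exact: cvg_cst.
by apply: cvg_det => i' j'; rewrite !mxE; under eq_fun do rewrite !mxE; exact: fl.
Qed.

(** A directional derivative is an ordinary derivative along a line; this makes the one-variable
    chain rule available on [V]. *)
Lemma is_derive1P (R : numFieldType) (V W : normedModType R) (f : V -> W)
    (x v : V) (df : W) :
  is_derive x v f df <-> is_derive (0 : R) 1 (fun h : R => f (h *: v + x)) df.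
Proof.
have E : (fun h : R => h^-1 *: (((fun h => f (h *: v + x)) \o shift 0)
      (h *: 1) - f (0 *: v + x))) =
    (fun h : R => h^-1 *: ((f \o shift x) (h *: v) - f x)).
  apply/funext => h /=.
  by rewrite scale0r addr0 add0r /GRing.scale/= mulr1.
by split=> -[fd <-]; split; rewrite /derivable/derive ?E //;
  move: fd; rewrite /derivable E.
Qed.

Lemma is_derive_comp (R : realType) (V : normedModType R) (g : R -> R)
    (f : V -> R) (x v : V) (a b : R) :
  is_derive (f x) 1 g a -> is_derive x v f b ->
  is_derive x v (fun y => g (f y)) (a * b).
Proof.
move=> ga /is_derive1P f1; apply/is_derive1P; apply: is_derive1_comp f1.
by rewrite scale0r add0r.
Qed.

Section DifferentialAlgebra.
Variables (R : realType) (V : normedModType R) (U : set V).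

Inductive generated_algebra (G : set (V -> R)) : set (V -> R) :=
| galg_gen g : G g -> generated_algebra G g
| galg_cst a : generated_algebra G (fun=> a)
| galg_add f g : generated_algebra G f -> generated_algebra G g ->
    generated_algebra G (fun x => f x + g x)
| galg_mul f g : generated_algebra G f -> generated_algebra G g ->
    generated_algebra G (fun x => f x * g x).

Lemma galg_sum G (I : Type) (r : seq I) (f : I -> V -> R) :
  (forall i, generated_algebra G (f i)) ->
  generated_algebra G (fun x => \sum_(i <- r) f i x).
Proof.
move=> Gf; elim: r => [|i r IHr].
- by under eq_fun do rewrite big_nil; exact: galg_cst.
- by under eq_fun do rewrite big_cons; exact: galg_add.
Qed.

Lemma galg_prod G (I : Type) (r : seq I) (f : I -> V -> R) :
  (forall i, generated_algebra G (f i)) ->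
  generated_algebra G (fun x => \prod_(i <- r) f i x).
Proof.
move=> Gf; elim: r => [|i r IHr].
- by under eq_fun do rewrite big_nil; exact: galg_cst.
- by under eq_fun do rewrite big_cons; exact: galg_mul.
Qed.

Lemma galg_det G k (f : V -> 'M[R]_k) :
  (forall i j, generated_algebra G (fun x => f x i j)) ->
  generated_algebra G (fun x => \det (f x)).
Proof.
move=> Gf; rewrite /determinant; apply: galg_sum => s.
by apply: galg_mul; [exact: galg_cst | apply: galg_prod].
Qed.

Lemma galg_adj G k (f : V -> 'M[R]_k) :
  (forall i j, generated_algebra G (fun x => f x i j)) ->
  forall i j, generated_algebra G (fun x => (\adj (f x)) i j).
Proof.
move=> Gf i j; under eq_fun do rewrite mxE.
apply: galg_mul; first exact: galg_cst.
by apply: galg_det => i' j'; under eq_fun do rewrite !mxE.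
Qed.

Lemma galg_mono G G' : G `<=` G' ->
  generated_algebra G `<=` generated_algebra G'.
Proof.
move=> GG' f; elim=> {f} [g /GG'|a|f g _ ? _ ?|f g _ ? _ ?].
- exact: galg_gen.
- exact: galg_cst.
- exact: galg_add.
- exact: galg_mul.
Qed.

(** Derivatives are matched with members of [C] on [U] only, since functions such as reciprocals are
    controlled only there. *)
Definition derivable_into (C : set (V -> R)) (f : V -> R) :=
  (forall x, U x -> {for x, continuous f}) /\
  forall v, exists2 g, C g & forall x, U x -> is_derive x v f (g x).

(** Sum and Leibniz rules. Keeping [G'] apart from [G] lets derivatives use generators that have not
    yet been shown derivable themselves. *)
Lemma derivable_into_galg G G' : G' `<=` G ->
  G' `<=` derivable_into (generated_algebra G) ->
  generated_algebra G' `<=` derivable_into (generated_algebra G).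
Proof.
move=> G'G G'd f; elim=> {f} [g /G'd//|a|f g|f g].
- split=> [x _|v]; first exact: cvg_cst.
  by exists (fun=> 0); [exact: galg_cst | move=> x _; exact: is_derive_cst].
- move=> G'f [fc fd] G'g [gc gd]; split=> [x Ux|v].
    by apply: cvgD; [exact: fc | exact: gc].
  have [df Gdf dfP] := fd v; have [dg Gdg dgP] := gd v.
  exists (fun x => df x + dg x); first exact: galg_add.
  by move=> x Ux; exact: is_deriveD (dfP _ Ux) (dgP _ Ux).
- move=> /(galg_mono G'G) Gf [fc fd] /(galg_mono G'G) Gg [gc gd].
  split=> [x Ux|v].
    by apply: cvgM; [exact: fc | exact: gc].
  have [df Gdf dfP] := fd v; have [dg Gdg dgP] := gd v.
  exists (fun x => f x * dg x + g x * df x).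
    by apply: galg_add; apply: galg_mul.
  by move=> x Ux; exact: is_deriveM (dfP _ Ux) (dgP _ Ux).
Qed.

(** Maps whose entries agree on [U] with members of the algebra form a class stable under ['D_v]: as
    [U] is open, derivatives at its points see only values on [U]. Induction on the list of
    directions then gives all orders. *)
Lemma Cinf_on_galg G p q (f : V -> 'M[R]_(p, q)) : open U ->
  G `<=` derivable_into (generated_algebra G) ->
  (forall i j, exists2 g, generated_algebra G g &
                          forall x, U x -> f x i j = g x) ->
  Cinf_on U f.
Proof.
move=> Uo Gd; have {}Gd := derivable_into_galg (@subset_refl _ _) Gd.
pose C (f : V -> 'M[R]_(p, q)) := forall i j, exists2 g,
  generated_algebra G g & forall x, U x -> f x i j = g x.
have nearU x : U x -> \near x, U x by move=> Ux; exact: open_nbhs_nbhs.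
have Cder (h : V -> 'M[R]_(p, q)) v x : C h -> U x -> derivable h x v.
  move=> Ch Ux; apply/derivable_mxP => i j; have [g Gg hg] := Ch i j.
  have [_ /(_ v)[dg _ /(_ _ Ux) [dgx _]]] := Gd _ Gg.
  apply: (near_eq_derivable _ dgx).
  by near=> y; apply/esym/hg; near: y; exact: nearU.
have CD (h : V -> 'M[R]_(p, q)) v : C h -> C (fun x => 'D_v h x).
  move=> Ch i j; have [g Gg hg] := Ch i j.
  have [_ /(_ v)[dg Gdg dgP]] := Gd _ Gg; exists dg => // x Ux.
  rewrite derive_mx ?mxE; last exact: Cder.
  have [_ <-] := dgP _ Ux; apply: near_eq_derive.
  by near=> y; apply: hg; near: y; exact: nearU.
have Ccont (h : V -> 'M[R]_(p, q)) x : C h -> U x -> {for x, continuous h}.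
  move=> Ch Ux; apply/cvg_mxP => i j; have [g Gg hg] := Ch i j.
  rewrite (hg _ Ux); have [/(_ _ Ux) + _] := Gd _ Gg.
  apply: cvg_trans; apply: near_eq_cvg.
  by near=> y; apply/esym/hg; near: y; exact: nearU.
move=> Cf vs; have : C (iter_dderiv vs f) by elim: vs => [|v vs IH]; [exact: Cf | exact: CD].
by move=> Cvs x Ux; split=> [|v]; [exact: Ccont | exact: Cder].
Unshelve. all: by end_near. Qed.

End DifferentialAlgebra.

(** * The moment equation and its solutions *)

Lemma cvg_sum0 (R : realType) (T I : Type) (F : set_system T) (r : seq I)
    (f : I -> T -> R) :
  Filter F -> (forall i, f i x @[x --> F] --> 0) ->
  (\sum_(i <- r) f i x) @[x --> F] --> 0.
Proof.
move=> FF f0.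
suff : (\sum_(i <- r) f i x) @[x --> F] --> \sum_(i <- r) (0 : R).
  by rewrite big1_eq.
by apply: cvg_big => [|i _]; [exact: add_continuous | exact: f0].
Qed.

(** The divided difference of [expR] at 0, extended by its limit 1. It makes increments of
    exponentials exactly linear, without a remainder term. *)
Definition expR_slope (R : realType) (u : R) : R :=
  if u == 0 then 1 else (expR u - 1) / u.

Lemma expR_slopeE (R : realType) (u : R) : expR_slope u * u = expR u - 1.
Proof.
rewrite /expR_slope; have [->|u0] := eqVneq u 0; first by rewrite expR0 mulr0 subrr.
by rewrite divfK.
Qed.

(** For [u >= 0] the slope is at least 1; for [u < 0] the bound follows from [expR u <= (1 - u)^-1].
    Decay no faster than [1 / |u|] is what later bounds an increment of unknown size. *)
Lemma expR_slope_ge (R : realType) (u : R) : (1 + `|u|)^-1 <= expR_slope u.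
Proof.
rewrite /expR_slope; have [->|u0] := eqVneq u 0.
  by rewrite normr0 addr0 invr1.
have [u_ge0|u_lt0] := leP 0 u.
  have u_gt0 : 0 < u by rewrite lt_def u0.
  rewrite (@le_trans _ _ 1)//; first by rewrite invf_le1 ?lerDl ?ltr_pwDl.
  by rewrite ler_pdivlMr//; have := expR_ge1Dx u; lra.
rewrite ler_ndivlMr// ltr0_norm//.
have e1 : expR u <= (1 - u)^-1.
  rewrite -[expR u]invrK lef_pV2 ?posrE ?invr_gt0 ?expR_gt0//; last lra.
  by rewrite -expRN; exact: expR_ge1Dx.
have -> : (1 - u)^-1 * u = (1 - u)^-1 - 1 by field; lra.
by rewrite lerD2r.
Qed.

Lemma expR_slope_gt0 (R : realType) (u : R) : 0 < expR_slope u.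
Proof. by apply: lt_le_trans (expR_slope_ge u); rewrite invr_gt0 ltr_pwDl. Qed.

Lemma cvg_expR_slope (R : realType) : expR_slope u @[u --> (0 : R)] --> (1 : R).
Proof.
have e1 : @expR_slope R 0 = 1 by rewrite /expR_slope eqxx.
rewrite -[X in _ --> X]e1; apply/continuous_withinNx; rewrite e1.
have [d v] := is_derive_expR (0 : R).
have : h^-1 *: ((expR \o shift 0) (h *: 1) - expR 0) @[h --> (0 : R)^'] -->
    'D_1 (expR : R -> R) 0 by exact: d.
rewrite v expR0.
apply: cvg_trans; apply: near_eq_cvg; near=> h.
have h0 : h != 0 by near: h; exact: nbhs_dnbhs_neq.
by rewrite /expR_slope (negbTE h0) /= addr0 /GRing.scale/= mulr1 mulrC.
Unshelve. all: by end_near. Qed.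

(** For [t < 0] the linear term suffices. For [t >= 0], compare with the tangent at [L], the point
    where [a * expR] has slope [2 * x]. The constant comes as data, so that it can be chosen for
    each index. *)
Lemma expR_coercive (R : realType) (a x : R) : 0 < a -> 0 < x ->
  {C | 0 <= C & forall t, x * `|t| - C <= a * expR t - x * t}.
Proof.
move=> a0 x0; set L := ln (2 * x / a); exists (2 * x * `|L|) => [|t].
  by rewrite !mulr_ge0// ltW.
have L0 : 0 <= 2 * x * `|L| by rewrite !mulr_ge0// ltW.
have e0 : 0 < a * expR t by rewrite mulr_gt0// expR_gt0.
have [t0|t0] := leP 0 t; last by rewrite ltr0_norm//; lra.
rewrite ger0_norm//.
have : 2 * x * (1 + (t - L)) <= a * expR t.
  rewrite (_ : a * expR t = 2 * x * expR (t - L)); last first.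
    rewrite expRB lnK ?posrE ?divr_gt0 ?mulr_gt0//.
    by field; rewrite !gt_eqF.
  by rewrite ler_pM2l ?mulr_gt0//; exact: expR_ge1Dx.
have : 2 * x * L <= 2 * x * `|L| by rewrite ler_pM2l ?mulr_gt0// ler_norm.
by nra.
Qed.

(** * Exponential tilts: existence and Hessian *)

Section LogLinear.
Variables (R : realType) (k p : nat) (B : 'M[R]_(k, p)) (B' : 'M[R]_(p, k)).
Hypothesis BB' : B *m B' = 1%:M.

(** The gradient in [z] of the convex potential that sums [a e * expR ((z *m B) 0 e)] over [e]. *)
Definition tilted_moment (a : 'I_p -> R) (z : 'rV[R]_k) (l : 'I_k) : R :=
  \sum_e a e * expR ((z *m B) 0 e) * B l e.

Lemma continuous_tilt e : continuous (fun z : 'rV[R]_k => (z *m B) 0 e).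
Proof.
rewrite (_ : (fun z => _) = fun z : 'rV[R]_k => \sum_l z 0 l * B l e).
  apply: continuous_big => [|l _]; first exact: add_continuous.
  move=> z; apply: (@continuousM R 'rV[R]_k (fun z => z 0 l) (fun=> B l e)).
    exact: coord_continuous.
  exact: cst_continuous.
by apply/funext => z; rewrite mxE.
Qed.

(** The potential minus its linear part attains a minimum, where the gradient vanishes. Positivity
    of [x] gives coercivity in each [(z *m B) 0 e], and [B'] carries the bounds over to [z]. *)
Lemma exists_tilt (a x : 'I_p -> R) :
  (forall e, 0 < a e) -> (forall e, 0 < x e) ->
  exists z, forall l, tilted_moment a z l = \sum_e x e * B l e.
Proof.
move=> a0 x0.
pose psi e t := a e * expR t - x e * t.
pose phi (z : 'rV[R]_k) := \sum_e psi e ((z *m B) 0 e).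
pose C e := s2val (expR_coercive (a0 e) (x0 e)).
have CP e t : x e * `|t| - C e <= psi e t.
  by rewrite /C; case: expR_coercive => /=.
have phic : continuous phi.
  apply: continuous_big => [|e _]; first exact: add_continuous.
  have psic : continuous (psi e).
    move=> t; apply: cvgB; apply: cvgM; try exact: cvg_cst; last exact: cvg_id.
    exact: continuous_expR.
  move=> z; exact: (continuous_comp (continuous_tilt (x := z)) (psic _)).
pose S := [set z | phi z <= phi 0].
pose K := phi 0 + \sum_e C e.
have SK z : S z -> forall e, `|(z *m B) 0 e| <= K / x e.
  move=> Sz e; rewrite ler_pdivlMr// mulrC.
  have : \sum_e (x e * `|(z *m B) 0 e| - C e) <= phi z by exact: ler_sum.
  rewrite sumrB lerBlDr => /le_trans/(_ (lerD Sz (lexx _))).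
  apply: le_trans; rewrite (bigD1 e)//= lerDl.
  by apply: sumr_ge0 => i _; rewrite mulr_ge0// ltW.
have S0 : S 0 by rewrite /S/=.
(* Bounds every coordinate of [z] in [S], because [z = z *m B *m B']. *)
pose M := \sum_l \sum_e K / x e * `|B' e l|.
have Kge0 e : 0 <= K / x e by exact: le_trans (normr_ge0 _) (SK _ S0 e).
have M0 (l : 'I_k) : 0 <= \sum_e K / x e * `|B' e l|.
  by apply: sumr_ge0 => e _; rewrite mulr_ge0.
have Sb : bounded_set S.
  exists M; split; first exact: num_real.
  move=> N MN z Sz; apply: le_trans (ltW MN).
  rewrite /Num.Def.normr/= mx_normrE; apply: bigmax_le => [|[i l] _ /=].
    by apply: sumr_ge0.
  rewrite ord1 -(mulmx1 z) -BB' mulmxA mxE.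
  rewrite (le_trans (ler_norm_sum _ _ _))//.
  rewrite /M (bigD1 l)//= ler_wpDr ?sumr_ge0//.
  by apply: ler_sum => e _; rewrite normrM ler_wpM2r// SK.
have Sc : closed S.
  apply: (@preimage_closed _ _ phi [set y | y <= phi 0]); last exact: closed_le.
  by move=> z _; exact: phic.
have [z zS zmin] := @EVT_min_rV R k phi S (ex_intro _ 0 S0)
  (bounded_closed_compact Sb Sc) (continuous_subspaceT phic).
have {}zmin y : phi z <= phi y.
  have [yS|yS] := leP (phi y) (phi 0); first by apply: zmin; rewrite inE.
  by move: zS; rewrite inE => /le_trans; apply; exact: ltW.
exists z => l; apply/eqP; rewrite -subr_eq0 -sumrB; apply/eqP.
(* Variation of the minimizer along the [l]-th coordinate; its vanishing derivative is the [l]-th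
   moment equation. *)
pose g (h : R) := phi (z + h *: delta_mx 0 l).
have gE h : g h = \sum_e psi e ((z *m B) 0 e + h * B l e).
  apply: eq_bigr => e _; congr psi.
  by rewrite mulmxDl -scalemxAl -rowE !mxE.
have gd (h : R) : is_derive h (1 : R) g
    (\sum_e (a e * (expR ((z *m B) 0 e + h * B l e) * B l e) - x e * B l e)).
  rewrite (_ : g = \sum_e (fun h => psi e ((z *m B) 0 e + h * B l e))); last first.
    by apply/funext => u; rewrite gE fct_sumE.
  apply: is_derive_sum => e.
  have lin : is_derive h (1 : R) (fun h : R => (z *m B) 0 e + h * B l e) (B l e).
    apply: (is_derive_eq (is_deriveD (is_derive_cst ((z *m B) 0 e) h 1)
      (is_deriveM (is_derive_id h 1) (is_derive_cst (B l e) h 1)))).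
    by rewrite /GRing.scale/= !mulr0 !add0r mulr1.
  apply: (is_derive_eq (is_deriveB
    (is_deriveM (is_derive_cst (a e) h 1) (is_derive_comp (is_derive_expR _) lin))
    (is_deriveM (is_derive_cst (x e) h 1) lin))).
  by rewrite /GRing.scale/= /cst !mulr0 !addr0.
have [_ g0] : is_derive (0 : R) (1 : R) g 0.
  apply: (@derive1_at_min R g (-1) 1); first lra.
  - by move=> t _; have [] := gd t.
  - by rewrite in_itv/=; apply/andP; split; lra.
  - by move=> t _; rewrite [X in X <= _]/g scale0r addr0; exact: zmin.
rewrite -[RHS]g0; have [_ ->] := gd 0.
by apply: eq_bigr => e _; rewrite mul0r addr0 mulrA.
Qed.

Definition tilt_hessian (d : 'I_p -> R) : 'M[R]_k :=
  \matrix_(m, l) \sum_e d e * (B m e * B l e).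

Lemma tilt_hessian_quad (d : 'I_p -> R) (v : 'rV[R]_k) :
  (v *m tilt_hessian d *m v^T) 0 0 = \sum_e d e * (v *m B) 0 e ^+ 2.
Proof.
rewrite mxE; under eq_bigr => l _.
  rewrite !mxE; under eq_bigr do rewrite mxE mulr_sumr.
  rewrite exchange_big /= mulr_suml.
  over.
rewrite exchange_big; apply: eq_bigr => e _ /=.
rewrite expr2 {2}mxE !mulr_sumr; apply: eq_bigr => l _.
rewrite mxE !(mulr_suml, mulr_sumr); apply: eq_bigr => m _.
by ring.
Qed.

(** A kernel vector [v] annihilates the quadratic form, so [v *m B = 0], and the right inverse [B']
    forces [v = 0]. *)
Lemma det_tilt_hessian (d : 'I_p -> R) :
  (forall e, 0 < d e) -> \det (tilt_hessian d) != 0.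
Proof.
move=> d0; apply/det0P => -[v v0 vH].
have := tilt_hessian_quad d v.
rewrite vH mul0mx mxE => /esym/eqP; rewrite psumr_eq0; last first.
  by move=> e _; rewrite mulr_ge0 ?sqr_ge0// ltW.
move=> /allP vB; case/eqP: v0.
rewrite -(mulmx1 v) -BB' mulmxA (_ : v *m B = 0) ?mul0mx//.
apply/rowP => e; rewrite [RHS]mxE; apply/eqP.
have := vB e (mem_index_enum e).
by rewrite mulf_eq0 gt_eqF//= sqrf_eq0.
Qed.

(** Termwise, the increment splits into [a] times the increment of the exponential, which
    [expR_slope] makes linear in [z - z0], and the increment of [a] times the old exponential. *)
Lemma tilted_moment_sub (a a0 : 'I_p -> R) (z z0 : 'rV[R]_k) l :
  tilted_moment a z l - tilted_moment a0 z0 l =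
  ((z - z0) *m tilt_hessian (fun e => a e * expR ((z0 *m B) 0 e) *
     expR_slope (((z - z0) *m B) 0 e))) 0 l +
  \sum_e (a e - a0 e) * expR ((z0 *m B) 0 e) * B l e.
Proof.
set d := fun e => _ * expR_slope _.
rewrite mxE (eq_bigr (fun i => \sum_e (z - z0) 0 i * (d e * (B i e * B l e)))).
  2: by move=> i _; rewrite [X in _ * X]mxE mulr_sumr.
rewrite exchange_big -big_split -sumrB; apply: eq_bigr => e _ /=.
have -> : \sum_i (z - z0) 0 i * (d e * (B i e * B l e)) =
  a e * expR ((z0 *m B) 0 e) * B l e *
    (expR_slope (((z - z0) *m B) 0 e) * ((z - z0) *m B) 0 e).
  rewrite /d; set s := expR_slope _.
  by rewrite [((z - z0) *m B) 0 e]mxE !mulr_sumr; apply: eq_bigr => i _; ring.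
rewrite expR_slopeE.
have -> : expR (((z - z0) *m B) 0 e) =
    expR ((z *m B) 0 e) / expR ((z0 *m B) 0 e).
  by rewrite mulmxBl -expRB !mxE.
by field; rewrite gt_eqF// expR_gt0.
Qed.

(** * Continuity and difference quotients of the tilt along a filter *)

Section Limits.
Variables (T : Type) (F : set_system T).
Hypothesis FF : Filter F.
Variables (a : T -> 'I_p -> R) (a0 : 'I_p -> R).
Variables (z : T -> 'rV[R]_k) (z0 : 'rV[R]_k).
Hypothesis a0_gt0 : forall e, 0 < a0 e.
Hypothesis cvg_a : forall e, a y e @[y --> F] --> a0 e.

Let s e := expR ((z0 *m B) 0 e).
Let s_gt0 e : 0 < s e. Proof. exact: expR_gt0. Qed.
Let h y e : R := ((z y - z0) *m B) 0 e.
Let d y e := a y e * s e * expR_slope (h y e).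
(** Right-hand side of the linear system satisfied by [z y - z0]. *)
Let rho y l := tilted_moment (a y) (z y) l - tilted_moment a0 z0 l -
  \sum_e (a y e - a0 e) * s e * B l e.

Let rhoE y l : ((z y - z0) *m tilt_hessian (d y)) 0 l = rho y l.
Proof. by rewrite /rho tilted_moment_sub addrK. Qed.

Let near_a_gt0 : \forall y \near F, forall e, 0 < a y e.
Proof. by apply: filter_forall => e; exact: cvgr_gt _ (@cvg_a e) _ (a0_gt0 e). Qed.

(** Pairing the linear system with the increment bounds its largest entry [H] by [tau * (1 + H)],
    where [tau] tends to 0. Hence [H <= 2 * tau] once [tau <= 1/2], with no prior bound on [z]. *)
Lemma cvg_tilt :
  (forall l, tilted_moment (a y) (z y) l @[y --> F] -->
             tilted_moment a0 z0 l) ->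
  forall e, (z y *m B) 0 e @[y --> F] --> (z0 *m B) 0 e.
Proof.
move=> cvg_m e.
pose sigma y e := \sum_l rho y l * B' e l.
(* Summing over all [e] covers whichever index carries the largest [h y e]. *)
pose tau y := \sum_e (\sum_e' `|sigma y e'|) / (a y e * s e).
have rho0 l : rho y l @[y --> F] --> 0.
  rewrite -[X in _ --> X](subrr 0); apply: cvgB.
    rewrite -[X in _ --> X](subrr (tilted_moment a0 z0 l)).
    by apply: cvgB => //; exact: cvg_cst.
  apply: cvg_sum0 => e'.
  rewrite -[X in _ --> X](mul0r (B l e')); apply: cvgM; last exact: cvg_cst.
  rewrite -[X in _ --> X](mul0r (s e')); apply: cvgM; last exact: cvg_cst.
  by rewrite -[X in _ --> X](subrr (a0 e')); apply: cvgB => //; exact: cvg_cst.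
have sigma0 e' : sigma y e' @[y --> F] --> 0.
  apply: cvg_sum0 => l.
  by rewrite -[X in _ --> X](mul0r (B' e' l)); apply: cvgM => //; exact: cvg_cst.
have tau0 : tau y @[y --> F] --> 0.
  apply: cvg_sum0 => e'.
  rewrite -[X in _ --> X](mul0r (a0 e' * s e')^-1); apply: cvgM; last first.
    apply: cvgV; first by rewrite gt_eqF// mulr_gt0.
    by apply: cvgM => //; exact: cvg_cst.
  apply: cvg_sum0 => e''.
  by rewrite -[X in _ --> X](normr0 R); apply: cvg_norm.
(* Substituting [(h y) *m B'] for [z y - z0] turns the pairing with [rho] into one of [h] with
   [sigma]. *)
have quad y : \sum_e d y e * h y e ^+ 2 = \sum_e h y e * sigma y e.
  rewrite -tilt_hessian_quad mxE.
  under eq_bigr do rewrite rhoE.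
  have zE l : (z y - z0)^T l 0 = \sum_e h y e * B' e l.
    by rewrite mxE -[in LHS](mulmx1 (z y - z0)) -BB' mulmxA mxE.
  under eq_bigr do rewrite zE mulr_sumr.
  rewrite exchange_big; apply: eq_bigr => e' _ /=.
  by rewrite mulr_sumr; apply: eq_bigr => l _; ring.
have bound y : (forall e, 0 < a y e) -> tau y <= 2^-1 -> `|h y e| <= 2 * tau y.
  move=> a_gt0 tau_le.
  have as_gt0 e' : 0 < a y e' * s e' by rewrite mulr_gt0.
  pose S := \sum_e' `|sigma y e'|.
  have S0 : 0 <= S by exact: sumr_ge0.
  have [e1 _ e1max] := @arg_maxP _ _ _ e xpredT (fun e => `|h y e|) isT.
  set H := `|h y e1| in e1max.
  apply: (le_trans (e1max e isT)).
  have H0 : 0 <= H by exact: normr_ge0.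
  suff : H <= tau y * (1 + H).
    have : tau y * H <= 2^-1 * H by exact: ler_wpM2r.
    by nra.
  have [->|Hn0] := eqVneq H 0.
    by rewrite addr0 mulr1; apply: sumr_ge0 => e' _; rewrite divr_ge0// ltW.
  have Hgt0 : 0 < H by rewrite lt_def Hn0.
  have key : d y e1 * H ^+ 2 <= H * S.
    rewrite real_normK ?num_real//.
    apply: (@le_trans _ _ (\sum_e d y e * h y e ^+ 2)).
      rewrite (bigD1 e1)//= lerDl; apply: sumr_ge0 => e' _.
      by rewrite mulr_ge0 ?sqr_ge0// mulr_ge0 ?ltW// expR_slope_gt0.
    rewrite quad /S mulr_sumr; apply: ler_sum => e' _.
    rewrite (le_trans (ler_norm _))// normrM ler_wpM2r//.
    exact: e1max.
  have d1 : a y e1 * s e1 / (1 + H) <= d y e1.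
    by rewrite /d ler_pM2l// expR_slope_ge.
  have : a y e1 * s e1 / (1 + H) * H <= S.
    rewrite -(ler_pM2l Hgt0); apply: le_trans key.
    by rewrite mulrCA -expr2 ler_pM2r// exprn_gt0.
  have tau1 : S / (a y e1 * s e1) <= tau y.
    by rewrite /tau (bigD1 e1)//= lerDl; apply: sumr_ge0 => e' _; rewrite divr_ge0// ltW.
  move=> HS; rewrite -ler_pdivrMr; last by lra.
  apply: le_trans tau1; rewrite ler_pdivlMr//.
  by apply: le_trans HS; rewrite le_eqVlt; apply/orP; left; apply/eqP; ring.
apply/subr_cvg0; apply/norm_cvg0P.
apply: (@squeeze_cvgr _ _ _ _ (fun=> 0) (fun y => 2 * tau y)).
- near=> y; rewrite normr_ge0/=.
  have -> : (z y *m B) 0 e - (z0 *m B) 0 e = h y e.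
    by rewrite /h mulmxBl !mxE.
  apply: bound; first by near: y; exact: near_a_gt0.
  near: y; apply: (cvgr_le _ tau0); lra.
- exact: cvg_cst.
- by rewrite -[X in _ --> X](mulr0 2); apply: cvgM => //; exact: cvg_cst.
Unshelve. all: by end_near. Qed.

(** Cramer's rule for the linear system scaled by [r y], whose matrix tends to an invertible limit.
    For directional derivatives, [r] is the inverse step. *)
Lemma cvg_tilt_quotient (r : T -> R) (a' : 'I_p -> R) (b' : 'I_k -> R) :
  (forall e, (z y *m B) 0 e @[y --> F] --> (z0 *m B) 0 e) ->
  (forall e, r y * (a y e - a0 e) @[y --> F] --> a' e) ->
  (forall l, r y * (tilted_moment (a y) (z y) l - tilted_moment a0 z0 l)
             @[y --> F] --> b' l) ->
  forall l, r y * (z y 0 l - z0 0 l) @[y --> F] -->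
    (\det (tilt_hessian (fun e => a0 e * s e)))^-1 *
    \sum_m (b' m - \sum_e a' e * s e * B m e) *
           (\adj (tilt_hessian (fun e => a0 e * s e))) m l.
Proof.
move=> cvg_t cvg_a' cvg_b' l.
have cvg_h e : h y e @[y --> F] --> 0.
  rewrite -[X in _ --> X](subrr ((z0 *m B) 0 e)) /h.
  under eq_fun do rewrite mulmxBl mxE [X in _ + X]mxE.
  by apply: cvgB => //; exact: cvg_cst.
have cvg_d e : d y e @[y --> F] --> a0 e * s e.
  rewrite -[X in _ --> X]mulr1; apply: cvgM.
    by apply: cvgM => //; exact: cvg_cst.
  exact: cvg_comp (cvg_h e) (@cvg_expR_slope R).
have cvg_H i j : (tilt_hessian (d y)) i j @[y --> F] -->
    (tilt_hessian (fun e => a0 e * s e)) i j.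
  rewrite mxE; under eq_fun do rewrite mxE.
  apply: cvg_big => [|e _]; first exact: add_continuous.
  by apply: cvgM => //; exact: cvg_cst.
have cvg_rho m : r y * rho y m @[y --> F] --> b' m - \sum_e a' e * s e * B m e.
  rewrite /rho; under eq_fun do rewrite mulrBr mulr_sumr.
  apply: cvgB => //; apply: cvg_big => [|e _]; first exact: add_continuous.
  by under eq_fun do rewrite !mulrA; do 2 (apply: cvgM; last exact: cvg_cst).
have det0 : \det (tilt_hessian (fun e => a0 e * s e)) != 0.
  by apply: det_tilt_hessian => e; rewrite mulr_gt0.
have lim : (\det (tilt_hessian (d y)))^-1 *
    (\sum_m r y * rho y m * (\adj (tilt_hessian (d y))) m l) @[y --> F] -->
    (\det (tilt_hessian (fun e => a0 e * s e)))^-1 *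
    \sum_m (b' m - \sum_e a' e * s e * B m e) *
           (\adj (tilt_hessian (fun e => a0 e * s e))) m l.
  apply: cvgM; first by apply: cvgV => //; exact: cvg_det.
  apply: cvg_big => [|m _]; first exact: add_continuous.
  by apply: cvgM => //; exact: cvg_adj.
(* The determinant is nonzero as soon as all [a y e] are positive, so the Cramer formula holds
   eventually. *)
apply: cvg_trans lim; apply: near_eq_cvg; near=> y.
have detn0 : \det (tilt_hessian (d y)) != 0.
  apply: det_tilt_hessian => e; rewrite !mulr_gt0 ?expR_slope_gt0//.
  by move: e; near: y; exact: near_a_gt0.
apply: (mulfI detn0); rewrite mulrA divff// mul1r.
have -> : \sum_m r y * rho y m * (\adj (tilt_hessian (d y))) m l =
    r y * (((z y - z0) *m tilt_hessian (d y)) *m \adj (tilt_hessian (d y))) 0 l.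
  rewrite [in RHS]mxE mulr_sumr; apply: eq_bigr => m _.
  by rewrite rhoE mulrA.
rewrite -mulmxA mul_mx_adj mul_mx_scalar !mxE.
by rewrite mulrCA.
Unshelve. all: by end_near. Qed.

End Limits.
End LogLinear.

(** * Smooth dependence of the solution *)

Lemma is_derive_cvg (R : numFieldType) (V W : normedModType R) (f : V -> W)
    (x v : V) (l : W) :
  h^-1 *: (f (h *: v + x) - f x) @[h --> 0^'] --> l -> is_derive x v f l.
Proof. by move=> fl; split; [exact: cvgP fl | exact: cvg_lim fl]. Qed.

Lemma cvg_is_derive (R : numFieldType) (V W : normedModType R) (f : V -> W)
    (x v : V) (l : W) :
  is_derive x v f l -> h^-1 *: (f (h *: v + x) - f x) @[h --> 0^'] --> l.
Proof. by move=> [fd <-]; exact: fd. Qed.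

Lemma cvg_line (R : realType) (V : normedModType R) (x v : V) :
  h *: v + x @[h --> (0 : R)^'] --> x.
Proof.
have c : {for (0 : R), continuous (fun h : R => h *: v + x)}.
  apply: (@continuousD R V R (fun h : R => h *: v) (fun=> x)).
    exact: scalel_continuous.
  exact: cst_continuous.
have : (h *: v + x) @[h --> (0 : R)] --> 0 *: v + x by exact: c.
rewrite scale0r add0r.
by apply: cvg_trans; apply: cvg_app; exact: nbhs_dnbhs.
Qed.

Lemma galg_subr (R : realType) (V : normedModType R) (G : set (V -> R)) f g :
  generated_algebra G f -> generated_algebra G g ->
  generated_algebra G (fun x => f x - g x).
Proof.
move=> Gf Gg; under eq_fun do rewrite -mulN1r.
by apply: galg_add => //; apply: galg_mul => //; exact: galg_cst.
Qed.

Section ImplicitTilt.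
Variables (R : realType) (k p : nat) (B : 'M[R]_(k, p)) (B' : 'M[R]_(p, k)).
Hypothesis BB' : B *m B' = 1%:M.
Variables (V : normedModType R) (U : set V) (G0 : set (V -> R)).
Variables (a : 'I_p -> V -> R) (b : 'I_k -> V -> R) (z : V -> 'rV[R]_k).
Hypothesis U_open : open U.
Hypothesis G0_derivable : G0 `<=` derivable_into U (generated_algebra G0).
Hypothesis G0a : forall e, generated_algebra G0 (a e).
Hypothesis G0b : forall l, generated_algebra G0 (b l).
Hypothesis a_gt0 : forall e x, U x -> 0 < a e x.
Hypothesis zP : forall x l, U x -> tilted_moment B (a^~ x) (z x) l = b l x.

Definition tilt_factor e x := expR ((z x *m B) 0 e).

(** The denominator of Cramer's rule; as a generator it closes the algebra under differentiation. *)
Definition inv_det_hessian x :=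
  (\det (tilt_hessian B (fun e => a e x * tilt_factor e x)))^-1.

Definition tilt_generators :=
  G0 `|` range tilt_factor `|` [set inv_det_hessian].

Let nearU x : U x -> \near x, U x.
Proof. by move=> Ux; exact: open_nbhs_nbhs. Qed.

Let galg0 : generated_algebra G0 `<=` derivable_into U (generated_algebra G0).
Proof. exact: derivable_into_galg. Qed.

Let G0G : generated_algebra G0 `<=` generated_algebra tilt_generators.
Proof. by apply: galg_mono => f G0f; left; left. Qed.

Let continuous_a e x : U x -> a e y @[y --> x] --> a e x.
Proof. by move=> Ux; have [+ _] := galg0 (G0a e); exact. Qed.

Let cvg_tilt_at e x : U x -> (z y *m B) 0 e @[y --> x] --> (z x *m B) 0 e.
Proof.
move=> Ux; apply: (@cvg_tilt _ _ _ _ _ BB' _ _ _ (fun y e => a e y) (a^~ x)).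
- by move=> e'; exact: a_gt0.
- by move=> e'; exact: continuous_a.
- move=> l; rewrite (zP _ Ux); have [/(_ _ Ux) bc _] := galg0 (G0b l).
  apply: cvg_trans bc; apply: near_eq_cvg; near=> y.
  by apply/esym/zP; near: y; exact: nearU.
Unshelve. all: by end_near. Qed.

(** Differentiating the moment equation gives a linear system with matrix [H]; its Cramer solution
    [dz] uses only derivatives of [a] and [b], tilt factors and [inv_det_hessian]. *)
Let is_derive_tilt v : exists2 D : 'I_p -> V -> R,
  forall e, generated_algebra tilt_generators (D e) &
  forall e x, U x -> is_derive x v (fun y => (z y *m B) 0 e) (D e x).
Proof.
have /choice[da daP] (e : 'I_p) : exists d, generated_algebra G0 d /\
    forall x, U x -> is_derive x v (a e) (d x).
  by have [_ /(_ v)[d ? ?]] := galg0 (G0a e); exists d.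
have /choice[db dbP] (l : 'I_k) : exists d, generated_algebra G0 d /\
    forall x, U x -> is_derive x v (b l) (d x).
  by have [_ /(_ v)[d ? ?]] := galg0 (G0b l); exists d.
pose H x := tilt_hessian B (fun e => a e x * tilt_factor e x).
pose dz l x := inv_det_hessian x *
  \sum_m (db m x - \sum_e da e x * tilt_factor e x * B m e) * (\adj (H x)) m l.
have GT e : generated_algebra tilt_generators (tilt_factor e).
  by apply: galg_gen; left; right; exists e.
have GH i j : generated_algebra tilt_generators (fun x => H x i j).
  under eq_fun do rewrite mxE.
  apply: galg_sum => e; apply: galg_mul; last exact: galg_cst.
  by apply: galg_mul => //; exact/G0G/G0a.
exists (fun e x => \sum_l dz l x * B l e) => [e|e x Ux].
  apply: galg_sum => l; apply: galg_mul; last exact: galg_cst.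
  apply: galg_mul; first by apply: galg_gen; right.
  apply: galg_sum => m; apply: galg_mul; last exact: galg_adj.
  apply: galg_subr; first by apply: G0G; have [] := dbP m.
  apply: galg_sum => e'; apply: galg_mul; last exact: galg_cst.
  by apply: galg_mul => //; apply: G0G; have [] := daP e'.
apply: is_derive_cvg.
have dzP l : h^-1 * (z (h *: v + x) 0 l - z x 0 l) @[h --> (0 : R)^'] --> dz l x.
  apply: (@cvg_tilt_quotient _ _ _ _ _ BB' _ _ _
    (fun h e => a e (h *: v + x)) (a^~ x) (fun h => z (h *: v + x))).
  - by move=> e'; exact: a_gt0.
  - move=> e'.
    exact: (@cvg_comp _ _ _ _ (a e') _ _ _ (@cvg_line _ _ x v) (@continuous_a e' x Ux)).
  - move=> e'; exact: (@cvg_comp _ _ _ _ (fun y => (z y *m B) 0 e') _ _ _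
      (@cvg_line _ _ x v) (@cvg_tilt_at e' x Ux)).
  - by move=> e'; have [_ /(_ _ Ux)/cvg_is_derive] := daP e'.
  - move=> m; have [_ /(_ _ Ux)/cvg_is_derive] := dbP m.
    apply: cvg_trans; apply: near_eq_cvg; near=> h.
    rewrite !zP//; near: h; apply: (@cvg_line _ _ x v); exact: nearU.
under eq_fun do rewrite !mxE -sumrB scaler_sumr.
apply: cvg_big => [|l _]; first exact: add_continuous.
have : h^-1 * (z (h *: v + x) 0 l - z x 0 l) * B l e @[h --> (0 : R)^'] -->
    dz l x * B l e by apply: cvgM; [exact: dzP | exact: cvg_cst].
by under eq_fun do rewrite -mulrA mulrBl.
Unshelve. all: by end_near. Qed.

Lemma tilt_generators_derivable :
  tilt_generators `<=` derivable_into U (generated_algebra tilt_generators).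
Proof.
have dG0 : G0 `<=` derivable_into U (generated_algebra tilt_generators).
  move=> f /G0_derivable[fc fd]; split=> // v.
  by have [g G0g gP] := fd v; exists g => //; exact: G0G.
have dT : range tilt_factor `<=`
    derivable_into U (generated_algebra tilt_generators).
  move=> _ [e _ <-]; split=> [x Ux|v].
    apply: (@continuous_cvg _ _ _ _ _ _ expR); first exact: continuous_expR.
    exact: cvg_tilt_at.
  have [D GD DP] := is_derive_tilt v.
  exists (fun x => tilt_factor e x * D e x).
    by apply: galg_mul => //; apply: galg_gen; left; right; exists e.
  by move=> x Ux; exact: is_derive_comp (is_derive_expR _) (DP _ _ Ux).
have dG1 : G0 `|` range tilt_factor `<=`
    derivable_into U (generated_algebra tilt_generators).
  by move=> f [/dG0|/dT].
move=> f [/dG1//|->].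
(* The determinant is a polynomial in [a] and the tilt factors, both already treated; the rule for
   reciprocals then handles its inverse. *)
pose dt x := \det (tilt_hessian B (fun e => a e x * tilt_factor e x)).
have dt0 x : U x -> dt x != 0.
  by move=> Ux; apply: det_tilt_hessian BB' _ _ => e; rewrite mulr_gt0 ?a_gt0 ?expR_gt0.
have [dtc dtd] : derivable_into U (generated_algebra tilt_generators) dt.
  apply: derivable_into_galg dG1 _ _; first by move=> g ?; left.
  apply: galg_det => i j; under [X in _ X]eq_fun do rewrite mxE.
  apply: galg_sum => e; apply: galg_mul; last exact: galg_cst.
  apply: galg_mul; last by apply: galg_gen; right; exists e.
  by apply: galg_mono (G0a e) => g ?; left.
split=> [x Ux|v]; first by apply: cvgV; [exact: dt0 | exact: dtc].
have [D GD DP] := dtd v.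
have Ginv : generated_algebra tilt_generators inv_det_hessian.
  by apply: galg_gen; right.
exists (fun x => -1 * (inv_det_hessian x * inv_det_hessian x) * D x).
  by apply: galg_mul => //; apply: galg_mul; [exact: galg_cst | exact: galg_mul].
move=> x Ux; have [ddt <-] := DP x Ux; split; first exact: derivableV (dt0 _ Ux) ddt.
by rewrite (deriveV (dt0 _ Ux) ddt) /inv_det_hessian mulN1r -expr2 exprVn.
Qed.

End ImplicitTilt.

(** * Convergence of Sinkhorn scaling *)

(** Odd indices are the row-normalized iterates. The even ones start at 2, since index 0 is the
    unscaled matrix. *)
Lemma cvg_even_odd (T : topologicalType) (u : nat -> T) (l : T) :
  u k.*2.+1 @[k --> \oo] --> l -> u k.*2.+2 @[k --> \oo] --> l ->
  u k @[k --> \oo] --> l.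
Proof.
move=> uodd ueven A lA.
have [N1 _ N1P] := uodd A lA; have [N2 _ N2P] := ueven A lA.
exists (N1 + N2).*2.+2 => // -[|[|k]]//= kN.
rewrite -[k]odd_double_half; case: (odd k) => /=.
- rewrite add1n -[_.*2.+3]/(_.+1.*2.+1); apply: N1P => /=.
  by have := odd_double_half k; lia.
- by rewrite add0n; apply: N2P => /=; have := odd_double_half k; lia.
Qed.

Section SinkhornConvergence.
Variables (R : realType) (n m : nat) (X : 'M[R]_(n, m)).
Variables (r : 'rV[R]_n) (c : 'rV[R]_m).
Hypothesis X_ge0 : forall i j, 0 <= X i j.
Hypothesis X_row : forall i, \sum_j X i j = r 0 i.
Hypothesis X_col : forall j, \sum_i X i j = c 0 j.
Hypothesis r_gt0 : forall i, 0 < r 0 i.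
Hypothesis c_gt0 : forall j, 0 < c 0 j.

Let row_mean (y : 'I_m -> R) i := (\sum_j X i j * y j) / r 0 i.
Let col_mean (w : 'I_n -> R) j := c 0 j / \sum_i X i j / w i.

Let sum_row_gt0 y i : (forall j, 0 < y j) -> 0 < \sum_j X i j * y j.
Proof.
move=> y0; rewrite lt_def sumr_ge0 ?andbT; last by move=> j _; rewrite mulr_ge0// ltW.
apply: contraTneq (r_gt0 i) => /eqP; rewrite psumr_eq0; last first.
  by move=> j _; rewrite mulr_ge0// ltW.
move=> /allP X0; rewrite -X_row big1 ?ltxx// => j _.
have := X0 j (mem_index_enum _); rewrite mulf_eq0 (gt_eqF (y0 j)) orbF.
by move/eqP.
Qed.

Let sum_col_gt0 w j : (forall i, 0 < w i) -> 0 < \sum_i X i j / w i.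
Proof.
move=> w0.
have w'0 i : 0 < (w i)^-1 by rewrite invr_gt0.
rewrite lt_def sumr_ge0 ?andbT; last by move=> i _; rewrite mulr_ge0// ltW.
apply: contraTneq (c_gt0 j) => /eqP; rewrite psumr_eq0; last first.
  by move=> i _; rewrite mulr_ge0// ltW.
move=> /allP X0; rewrite -X_col big1 ?ltxx// => i _.
have := X0 i (mem_index_enum _); rewrite mulf_eq0 (gt_eqF (w'0 i)) orbF.
by move/eqP.
Qed.

Let row_mean_ge mu y : 0 < mu -> (forall j, mu <= y j) ->
  forall i, mu <= row_mean y i.
Proof.
move=> mu0 muy i; rewrite /row_mean ler_pdivlMr// -X_row mulr_sumr.
by apply: ler_sum => j _; rewrite mulrC ler_wpM2l.
Qed.

Let col_mean_ge mu w : 0 < mu -> (forall i, mu <= w i) ->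
  forall j, mu <= col_mean w j.
Proof.
move=> mu0 muw j; have w0 i : 0 < w i by exact: lt_le_trans (muw i).
rewrite /col_mean ler_pdivlMr ?sum_col_gt0// -X_col mulr_sumr.
apply: ler_sum => i _; rewrite mulrCA -[leRHS]mulr1 ler_wpM2l//.
by rewrite ler_pdivrMr// mul1r.
Qed.

(** The previous row factor [v] cancels, so [y] alone determines the next iterate. *)
Lemma row_normalize_scaled (A : 'M[R]_(n, m)) y v :
  (forall j, 0 < y j) -> (forall i, 0 < v i) ->
  (forall i j, A i j = X i j * y j * v i) ->
  forall i j, row_normalize r A i j = X i j * y j / row_mean y i.
Proof.
move=> y0 v0 AE i j; rewrite mxE AE.
under eq_bigr do rewrite AE; rewrite -mulr_suml /row_mean.
by field; rewrite !gt_eqF// sum_row_gt0.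
Qed.

Lemma col_normalize_scaled (A : 'M[R]_(n, m)) y w :
  (forall j, 0 < y j) -> (forall i, 0 < w i) ->
  (forall i j, A i j = X i j * y j / w i) ->
  forall i j, col_normalize c A i j = X i j * col_mean w j / w i.
Proof.
move=> y0 w0 AE i j; rewrite mxE AE.
under eq_bigr do rewrite AE -mulrA mulrCA; rewrite -mulr_sumr /col_mean.
by field; rewrite !gt_eqF// sum_col_gt0.
Qed.

Let energy (y : 'I_m -> R) := \sum_j c 0 j * y j ^+ 2.

(* Variance decomposition: X is a coupling of the weights r and c. *)
Let energy_row y : energy y - \sum_i r 0 i * row_mean y i ^+ 2 =
  \sum_i \sum_j X i j * (y j - row_mean y i) ^+ 2.
Proof.
have -> : energy y = \sum_i \sum_j X i j * y j ^+ 2.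
  rewrite exchange_big; apply: eq_bigr => j _.
  by rewrite -X_col mulr_suml.
rewrite -sumrB; apply: eq_bigr => i _.
have E : \sum_j X i j * y j = r 0 i * row_mean y i.
  by rewrite /row_mean mulrC divfK// gt_eqF.
transitivity (\sum_j X i j * y j ^+ 2 - 2 * row_mean y i * \sum_j X i j * y j
  + row_mean y i ^+ 2 * \sum_j X i j).
  by rewrite E X_row; ring.
rewrite !mulr_sumr -sumrB -big_split; apply: eq_bigr => j _ /=; ring.
Qed.

(** Jensen's inequality for [s^-2]: the square of a weighted harmonic mean is at most the weighted
    mean of the squares. *)
Let energy_col w : (forall i, 0 < w i) ->
  energy (col_mean w) <= \sum_i r 0 i * w i ^+ 2.
Proof.
move=> w0.
have -> : \sum_i r 0 i * w i ^+ 2 = \sum_j \sum_i X i j * w i ^+ 2.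
  rewrite exchange_big; apply: eq_bigr => i _.
  by rewrite -X_row mulr_suml.
apply: ler_sum => j _; set u := col_mean w j.
have u0 : 0 < u by rewrite divr_gt0// sum_col_gt0.
have E : u * \sum_i X i j / w i = c 0 j.
  by rewrite /u /col_mean divfK// gt_eqF// sum_col_gt0.
(* Tangent of the convex function s |-> s^-2 at s = u^-1. *)
have tangent i : 3 * u ^+ 2 - 2 * u ^+ 3 / w i <= w i ^+ 2.
  have -> : 3 * u ^+ 2 - 2 * u ^+ 3 / w i =
      w i ^+ 2 - (w i - u) ^+ 2 * (w i + 2 * u) / w i.
    by field; rewrite gt_eqF.
  rewrite gerBl divr_ge0 ?(ltW (w0 i))// mulr_ge0 ?sqr_ge0//.
  by have := w0 i; lra.
(* The tangents average to [u ^+ 2] because [E] fixes the weighted mean of [1 / w i] at [1 / u]. *)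
have -> : c 0 j * u ^+ 2 = \sum_i X i j * (3 * u ^+ 2 - 2 * u ^+ 3 / w i).
  transitivity (3 * u ^+ 2 * (\sum_i X i j) - 2 * u ^+ 2 * (u * \sum_i X i j / w i)).
    by rewrite E X_col; ring.
  rewrite !mulr_sumr -sumrB; apply: eq_bigr => i _; ring.
by apply: ler_sum => i _; rewrite ler_wpM2l.
Qed.

(** The squared error of an entry after a row step is [X i j ^+ 2 * (y k j - w k i) ^+ 2 / w k i ^+
    2]. A uniform lower bound on [w] makes it at most a constant times the energy drop, which tends
    to 0. *)
Lemma sinkhorn_iter_cvg (A : 'M[R]_(n, m)) (x0 : 'I_n -> R) (y0 : 'I_m -> R) :
  (forall i, 0 < x0 i) -> (forall j, 0 < y0 j) ->
  (forall i j, A i j = X i j * y0 j * x0 i) ->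
  sinkhorn_iter r c A k @[k --> \oo] --> X.
Proof.
move=> x0_gt0 y0_gt0 AE.
pose y k := iter k (col_mean \o row_mean) y0.
(* A positive lower bound of [y0], preserved by both means; the summand 1 keeps it positive even for
   an empty sum. *)
pose mu := (1 + \sum_j (y0 j)^-1)^-1.
have Sge0 : 0 <= \sum_j (y0 j)^-1 by apply: sumr_ge0 => j _; rewrite invr_ge0 ltW.
have mu0 : 0 < mu by rewrite invr_gt0 ltr_pwDl.
have muy k : forall j, mu <= y k j.
  elim: k => [|k IHk] j.
    rewrite /mu -[leRHS]invrK lef_pV2 ?posrE ?invr_gt0// ?ltr_pwDl//.
    rewrite (bigD1 j)//= addrCA lerDl addr_ge0//.
    by apply: sumr_ge0 => i _; rewrite invr_ge0 ltW.
  by apply: col_mean_ge => //; exact: row_mean_ge.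
have y_gt0 k j : 0 < y k j by exact: lt_le_trans (muy k j).
pose w k := row_mean (y k).
have muw k i : mu <= w k i by exact: row_mean_ge.
have w_gt0 k i : 0 < w k i by exact: lt_le_trans (muw k i).
(* The factor [v] is [x0] at the start and the inverse of the preceding row mean afterwards. *)
have row_step k v : (forall i, 0 < v i) ->
    (forall i j, sinkhorn_iter r c A k.*2 i j = X i j * y k j * v i) ->
    forall i j, sinkhorn_iter r c A k.*2.+1 i j = X i j * y k j / w k i.
  by move=> v0 itE i j; rewrite /= odd_double; exact: row_normalize_scaled itE _ _.
have col_step k : (forall i j, sinkhorn_iter r c A k.*2.+1 i j =
      X i j * y k j / w k i) ->
    forall i j, sinkhorn_iter r c A k.+1.*2 i j = X i j * y k.+1 j / w k i.
  move=> itE i j; rewrite doubleS /= odd_double /=.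
  by move: itE; rewrite /= odd_double => /col_normalize_scaled ->.
have odd_iter k : forall i j,
    sinkhorn_iter r c A k.*2.+1 i j = X i j * y k j / w k i.
  elim: k => [|k /col_step IHk]; first exact: (row_step 0%N x0).
  by apply: (row_step k.+1 (fun i => (w k i)^-1)) => // i; rewrite invr_gt0.
have drop_ge k : \sum_i \sum_j X i j * (y k j - w k i) ^+ 2 <=
    energy (y k) - energy (y k.+1).
  by rewrite -energy_row lerD2l lerN2; apply: energy_col; exact: w_gt0.
have drop_term k i j : X i j * (y k j - w k i) ^+ 2 <=
    energy (y k) - energy (y k.+1).
  apply: le_trans (drop_ge k).
  have pos i' j' : 0 <= X i' j' * (y k j' - w k i') ^+ 2 by rewrite mulr_ge0 ?sqr_ge0.
  rewrite (bigD1 i)//= (bigD1 j)//= -addrA lerDl addr_ge0 ?sumr_ge0// => *.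
  by rewrite sumr_ge0.
have energy_cvg : cvgn (energy \o y).
  apply: nonincreasing_is_cvgn; last first.
    exists 0 => _ [k _ <-] /=; apply: sumr_ge0 => j _.
    by rewrite mulr_ge0 ?sqr_ge0// ltW.
  apply/nonincreasing_seqP => k /=; rewrite -subr_ge0.
  apply: le_trans (drop_ge k); apply: sumr_ge0 => i _; apply: sumr_ge0 => j _.
  by rewrite mulr_ge0 ?sqr_ge0.
have drop0 : energy (y k) - energy (y k.+1) @[k --> \oo] --> 0.
  rewrite -[X in _ --> X](subrr (limn (energy \o y))).
  apply: cvgB; first exact: energy_cvg.
  have := energy_cvg; rewrite -(@cvg_shiftS R (energy \o y)).
  exact.
have odd_cvg i j : sinkhorn_iter r c A k.*2.+1 i j @[k --> \oo] --> X i j.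
  under eq_fun do rewrite odd_iter.
  have bnd : X i j / mu ^+ 2 * (energy (y k) - energy (y k.+1)) @[k --> \oo] --> 0.
    by rewrite -[X in _ --> X](mulr0 (X i j / mu ^+ 2)); apply: cvgM => //; exact: cvg_cst.
  apply/cvgrPdist_lt => e e0; near=> k.
  rewrite -(ltr_pXn2r (n := 2))// ?nnegrE ?(ltW e0)// real_normK ?num_real//.
  apply: (@le_lt_trans _ _ (X i j / mu ^+ 2 * (energy (y k) - energy (y k.+1)))).
    apply: (@le_trans _ _ (X i j / mu ^+ 2 * (X i j * (y k j - w k i) ^+ 2))); last first.
      by rewrite ler_wpM2l// divr_ge0// sqr_ge0.
    have -> : (X i j - X i j * y k j / w k i) ^+ 2 =
        X i j * (X i j * (y k j - w k i) ^+ 2) * (w k i ^+ 2)^-1.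
      by field; rewrite gt_eqF.
    rewrite [leRHS]mulrAC ler_wpM2l ?(sqr_ge0, mulr_ge0)//.
    by rewrite lef_pV2 ?posrE ?exprn_gt0// lerXn2r ?nnegrE// ltW.
  by near: k; apply: cvgr_lt bnd _ _; rewrite exprn_gt0.
apply: cvg_even_odd; apply/cvg_mxP => // i j.
(* Even iterates are column normalizations of odd ones; this operation is continuous at [X] and
   fixes it, its column sums being the positive [c 0 j]. *)
have -> : (fun k => sinkhorn_iter r c A k.*2.+2 i j) = fun k =>
    sinkhorn_iter r c A k.*2.+1 i j * c 0 j /
    \sum_i' sinkhorn_iter r c A k.*2.+1 i' j.
  by apply/funext => k; rewrite [sinkhorn_iter]lock /= -lock /= odd_double /= mxE.
have <- : X i j * c 0 j / (\sum_i' X i' j) = X i j.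
  by rewrite X_col mulfK// gt_eqF.
apply: cvgM; first by apply: cvgM => //; exact: cvg_cst.
apply: cvgV; first by rewrite X_col gt_eqF.
by apply: cvg_big => [|i' _]; [exact: add_continuous | exact: odd_cvg].
Unshelve. all: by end_near. Qed.

End SinkhornConvergence.

(** * The local smooth extension *)

Lemma is_derive_linear (R : numFieldType) (V W : normedModType R) (f : V -> W)
    (x v : V) :
  (forall h w y, f (h *: w + y) = h *: f w + f y) -> is_derive x v f (f v).
Proof.
move=> flin; apply: is_derive_cvg.
apply: (@cvg_trans _ ((fun=> f v) @ (0 : R)^')); last exact: cvg_cst.
apply: near_eq_cvg; near=> h; rewrite flin addrK scalerA mulVf ?scale1r//.
by near: h; exact: nbhs_dnbhs_neq.
Unshelve. all: by end_near. Qed.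

(** * The incidence matrix of the bipartite graph of the pattern *)

Section Incidence.
Variables (R : realType) (n m : nat) (P : {set 'I_n * 'I_m}).

Definition edge (e : 'I_#|P|) : 'I_n * 'I_m := enum_val e.

Definition incidence : 'M[R]_(n + m, #|P|) :=
  \matrix_(s, e) (match fintype.split s with
                  | inl i => (edge e).1 == i
                  | inr j => (edge e).2 == j
                  end)%:R.

Lemma edge_in e : ((edge e).1, (edge e).2) \in P.
Proof. by rewrite -surjective_pairing; exact: enum_valP. Qed.

Lemma edgeP i j : (i, j) \in P -> exists e, edge e = (i, j).
Proof. by move=> ijP; exists (enum_rank_in ijP (i, j)); exact: enum_rankK_in. Qed.

Lemma edge_inj : injective edge.
Proof. exact: enum_val_inj. Qed.

(** The row space of the incidence matrix thus consists of the logarithms of diagonal scalings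
    restricted to the pattern. *)
Lemma mul_incidence (w : 'rV[R]_(n + m)) e :
  (w *m incidence) 0 e = w 0 (lshift m (edge e).1) + w 0 (rshift n (edge e).2).
Proof.
rewrite mxE big_split_ord /=; congr (_ + _).
- rewrite (bigD1 (edge e).1)//= big1 ?addr0 => [|i ine].
    by rewrite mxE -[lshift _ _]/(unsplit (inl _)) unsplitK eqxx mulr1.
  rewrite mxE -[lshift _ _]/(unsplit (inl _)) unsplitK.
  by rewrite eq_sym (negbTE ine) mulr0.
- rewrite (bigD1 (edge e).2)//= big1 ?addr0 => [|j jne].
    by rewrite mxE -[rshift _ _]/(unsplit (inr _)) unsplitK eqxx mulr1.
  rewrite mxE -[rshift _ _]/(unsplit (inr _)) unsplitK.
  by rewrite eq_sym (negbTE jne) mulr0.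
Qed.

Lemma incidence_moment (Y : 'M[R]_(n, m)) (r : 'rV[R]_n) (c : 'rV[R]_m) :
  (forall i j, (i, j) \notin P -> Y i j = 0) ->
  ((forall i, \sum_j Y i j = r 0 i) /\ (forall j, \sum_i Y i j = c 0 j)) <->
  (forall s, \sum_e Y (edge e).1 (edge e).2 * incidence s e = row_mx r c 0 s).
Proof.
move=> Y0.
have sumE (f : 'I_n * 'I_m -> R) :
    \sum_e Y (edge e).1 (edge e).2 * f (edge e) = \sum_i \sum_j Y i j * f (i, j).
  transitivity (\sum_(x in P) Y x.1 x.2 * f x).
    by rewrite [RHS]big_enum_val; exact: eq_bigr.
  rewrite pair_bigA /= big_mkcond; apply: eq_bigr => -[i j] _ /=.
  by case: ifPn => // ijP; rewrite Y0 ?mul0r.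
have rowE i : \sum_e Y (edge e).1 (edge e).2 * incidence (lshift m i) e = \sum_j Y i j.
  under eq_bigr do rewrite mxE -[lshift _ _]/(unsplit (inl _)) unsplitK.
  rewrite (sumE (fun x => (x.1 == i)%:R)) (bigD1 i)//= [X in _ + X]big1 ?addr0.
    by apply: eq_bigr => j _; rewrite eqxx mulr1.
  by move=> i' ine; rewrite big1// => j _; rewrite (negbTE ine) mulr0.
have colE j : \sum_e Y (edge e).1 (edge e).2 * incidence (rshift n j) e = \sum_i Y i j.
  under eq_bigr do rewrite mxE -[rshift _ _]/(unsplit (inr _)) unsplitK.
  rewrite (sumE (fun x => (x.2 == j)%:R)) exchange_big (bigD1 j)//=.
  rewrite [X in _ + X]big1 ?addr0.
    by apply: eq_bigr => i _; rewrite eqxx mulr1.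
  by move=> j' jne; rewrite big1// => i _; rewrite (negbTE jne) mulr0.
split=> [[Yr Yc] s|YE].
- case: (split_ordP s) => [i ->|j ->].
    by rewrite rowE row_mxEl.
  by rewrite colE row_mxEr.
- by split=> [i|j]; [rewrite -rowE YE row_mxEl | rewrite -colE YE row_mxEr].
Qed.

End Incidence.

(** * Extension of the Sinkhorn limit to an open neighbourhood *)

Section SmoothExtension.
Variables (R : realType) (lambda : R) (n m : nat) (P : {set 'I_n * 'I_m}).

Notation V := ('M[R]_(n, m) * 'rV[R]_n * 'rV[R]_m)%type.
Notation E := (incidence R P).

Let k := \rank E.
Let B : 'M[R]_(k, #|P|) := row_base E.

Definition entry_at (e : 'I_#|P|) (x : V) : R := x.1.1 (edge e).1 (edge e).2.
Definition weight (e : 'I_#|P|) (x : V) : R := entry_at e x `^ lambda.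

(** [C] and [D] translate between [E], whose rows may be dependent, and the basis [B] of its row
    space, whose independence gives an invertible Hessian. *)
Variable C : 'M[R]_(k, n + m).
Hypothesis BE : B = C *m E.
Variable D : 'M[R]_(n + m, k).
Hypothesis EB : E = D *m B.
Variable B' : 'M[R]_(#|P|, k).
Hypothesis BB' : B *m B' = 1%:M.

(** Linear in the marginals through [B = C *m E], and so defined for all of them, scalable or
    not. *)
Definition moment (l : 'I_k) (x : V) : R :=
  \sum_s C l s * row_mx x.1.2 x.2 0 s.

Variable x0 : V.
Variable X0 : 'M[R]_(n, m).

(* X0 corrected through the right inverse B' of B; still positive near x0. *)
Definition witness (e : 'I_#|P|) (x : V) : R :=
  X0 (edge e).1 (edge e).2 + \sum_l (moment l x - moment l x0) * B' e l.

(** Only strict inequalities on continuous functions occur, so this is open in the whole space;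
    entries off the pattern and scalability are left free. *)
Definition good_nbhd : set V :=
  [set x | forall e, 0 < entry_at e x /\ 0 < witness e x].

Lemma continuous_entry_at e : continuous (entry_at e).
Proof.
move=> x; apply: (@cvg_comp _ _ _ (fun y : V => y.1.1)
  (fun M : 'M[R]_(n, m) => M (edge e).1 (edge e).2)); last exact: coord_continuous.
exact: cvg_comp cvg_fst cvg_fst.
Qed.

Lemma continuous_moment l : continuous (moment l).
Proof.
apply: continuous_big => [|s _ x]; first exact: add_continuous.
apply: (@continuousM R V (fun=> C l s)); first exact: cst_continuous.
case: (split_ordP s) => [i ->|j ->].
- rewrite (_ : (fun _ => _) = fun y : V => y.1.2 0 i); last first.
    by apply/funext => y; rewrite row_mxEl.
  apply: (@cvg_comp _ _ _ (fun y : V => y.1.2) (fun M : 'rV[R]_n => M 0 i));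
    last exact: coord_continuous.
  exact: cvg_comp cvg_fst cvg_snd.
- rewrite (_ : (fun _ => _) = fun y : V => y.2 0 j); last first.
    by apply/funext => y; rewrite row_mxEr.
  apply: (@cvg_comp _ _ _ (fun y : V => y.2) (fun M : 'rV[R]_m => M 0 j));
    last exact: coord_continuous.
  exact: cvg_snd.
Qed.

Lemma continuous_witness e : continuous (witness e).
Proof.
move=> x; apply: (@continuousD R R V (fun=> _)); first exact: cst_continuous.
apply: (@continuous_big _ _ _ _ _ _ V) => [|l _ y]; first exact: add_continuous.
apply: (@continuousM R V _ (fun=> B' e l)); last exact: cst_continuous.
apply: (@continuousB R R V _ (fun=> _)); last exact: cst_continuous.
exact: continuous_moment.
Qed.

Lemma open_good_nbhd : open good_nbhd.
Proof.
have near_pos (f : V -> R) x : continuous f -> 0 < f x -> \forall y \near x, 0 < f y.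
  by move=> fc; exact: cvgr_gt _ (fc x) _.
rewrite openE => x Ux.
suff : \forall y \near x, forall e, 0 < entry_at e y /\ 0 < witness e y by [].
apply: (@filter_forall V _ (fun e y => 0 < entry_at e y /\ 0 < witness e y) _
  (nbhs_filter x)) => e.
have [Me We] := Ux e.
near=> y; split; near: y.
- exact: near_pos (@continuous_entry_at e) Me.
- exact: near_pos (@continuous_witness e) We.
Unshelve. all: by end_near. Qed.

Lemma is_derive_entry_at e x v : is_derive x v (entry_at e) (entry_at e v).
Proof. by apply: is_derive_linear => h w y; rewrite /entry_at /= !mxE. Qed.

Lemma is_derive_moment l x v : is_derive x v (moment l) (moment l v).
Proof.
apply: is_derive_linear => h w y; rewrite /moment scaler_sumr -big_split.
apply: eq_bigr => s _ /=.
have -> : row_mx (h *: w + y).1.2 (h *: w + y).2 =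
    h *: row_mx w.1.2 w.2 + row_mx y.1.2 y.2.
  by rewrite scale_row_mx add_row_mx.
rewrite [(_ + row_mx _ _) 0 s]mxE [(_ *: row_mx _ _) 0 s]mxE.
by rewrite /GRing.scale/=; ring.
Qed.

(** Reciprocals of entries are included because the derivative of [t]^ lambda[is]lambda * t
    [^ lambda / t]. *)
Definition base_generators : set (V -> R) :=
  range weight `|` range (fun e x => (entry_at e x)^-1) `|` range moment.

Lemma base_generators_derivable : base_generators `<=`
  derivable_into good_nbhd (generated_algebra base_generators).
Proof.
have Gw e : generated_algebra base_generators (weight e).
  by apply: galg_gen; left; left; exists e.
have Gi e : generated_algebra base_generators (fun x => (entry_at e x)^-1).
  by apply: galg_gen; left; right; exists e.
move=> _ [[[e _ <-]|[e _ <-]]|[l _ <-]]; split.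
- move=> x Ux; have [Me _] := Ux e; have [pd _] := is_derive1_powR lambda Me.
  apply: (@continuous_comp _ _ _ (entry_at e) (fun t => t `^ lambda)).
    exact: continuous_entry_at.
  by apply: differentiable_continuous; apply/derivable1_diffP.
- move=> v; exists (fun x => lambda * entry_at e v * (weight e x * (entry_at e x)^-1)).
    by apply: galg_mul; [exact: galg_cst | exact: galg_mul].
  move=> x Ux; have [Me _] := Ux e.
  apply: is_derive_eq (is_derive_comp (is_derive1_powR lambda Me)
    (is_derive_entry_at e x v)) _.
  by rewrite /weight powRB ?(lt0r_neq0 Me) ?implybT// powRr1 ?(ltW Me)//; ring.
- move=> x Ux; have [Me _] := Ux e; apply: continuousV; first by rewrite gt_eqF.
  exact: continuous_entry_at.
- move=> v; exists (fun x => - entry_at e v * ((entry_at e x)^-1 * (entry_at e x)^-1)).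
    by apply: galg_mul; [exact: galg_cst | exact: galg_mul].
  move=> x Ux; have [/lt0r_neq0 Me _] := Ux e.
  have [dM vM] := is_derive_entry_at e x v.
  split; first exact: derivableV Me dM.
  by rewrite (deriveV Me dM) vM -expr2 exprVn /GRing.scale/=; ring.
- by move=> x _; exact: continuous_moment.
- move=> v; exists (fun=> moment l v); first exact: galg_cst.
  by move=> x _; exact: is_derive_moment.
Qed.

Hypothesis X0P : forall i j, (i, j) \notin P -> X0 i j = 0.
Hypothesis X0_row : forall i, \sum_j X0 i j = x0.1.2 0 i.
Hypothesis X0_col : forall j, \sum_i X0 i j = x0.2 0 j.

Lemma moment_marginals (Y : 'M[R]_(n, m)) (x : V) l :
  (forall i j, (i, j) \notin P -> Y i j = 0) ->
  (forall i, \sum_j Y i j = x.1.2 0 i) -> (forall j, \sum_i Y i j = x.2 0 j) ->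
  \sum_e Y (edge e).1 (edge e).2 * B l e = moment l x.
Proof.
move=> Y0 Yr Yc; have /(incidence_moment _ _ Y0) YE := conj Yr Yc.
rewrite /moment; under [RHS]eq_bigr do rewrite -YE mulr_sumr.
rewrite exchange_big; apply: eq_bigr => e _ /=.
by rewrite BE mxE mulr_sumr; apply: eq_bigr => s _; rewrite mulrCA.
Qed.

(** [X0] has the moments of [x0], and [BB'] makes the correction contribute exactly the
    difference. *)
Lemma witness_moment l x : \sum_e witness e x * B l e = moment l x.
Proof.
under eq_bigr do rewrite mulrDl mulr_suml.
rewrite big_split /= (@moment_marginals X0 x0 l X0P X0_row X0_col) exchange_big /=.
under eq_bigr => l' _.
  rewrite (eq_bigr (fun e => (moment l' x - moment l' x0) * (B l e * B' e l'))).
    2: by move=> e _; rewrite -mulrA [B' e l' * _]mulrC.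
  rewrite -mulr_sumr.
  have -> : \sum_e B l e * B' e l' = (B *m B') l l' by rewrite mxE.
  rewrite BB' mxE.
  over.
rewrite (bigD1 l)//= eqxx mulr1 big1 ?addr0; first by rewrite addrC subrK.
by move=> l' ll'; rewrite eq_sym (negbTE ll') mulr0.
Qed.

Lemma exists_good_tilt : exists z : V -> 'rV[R]_k, forall x l,
  good_nbhd x -> tilted_moment B (weight^~ x) (z x) l = moment l x.
Proof.
suff /choice[z zP] (x : V) : exists z : 'rV[R]_k, good_nbhd x -> forall l,
    tilted_moment B (weight^~ x) z l = moment l x.
  by exists z => x l Ux; exact: zP.
have [Ux|nUx] := pselect (good_nbhd x); last by exists 0.
have [z zP] := @exists_tilt _ _ _ _ _ BB' (weight^~ x) (witness^~ x)
  (fun e => powR_gt0 _ (Ux e).1) (fun e => (Ux e).2).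
by exists z => _ l; rewrite zP witness_moment.
Qed.

Variable z : V -> 'rV[R]_k.
Hypothesis zP : forall x l,
  good_nbhd x -> tilted_moment B (weight^~ x) (z x) l = moment l x.

(** The indicator of the edge presents every entry, on or off the pattern, as a sum of products of
    generators and constants. *)
Definition extension (x : V) : 'M[R]_(n, m) := \matrix_(i, j)
  \sum_e weight e x * tilt_factor B z e x * (edge e == (i, j))%:R.

Lemma extension_edge x e : extension x (edge e).1 (edge e).2 =
  weight e x * tilt_factor B z e x.
Proof.
rewrite mxE (bigD1 e)//= -surjective_pairing eqxx mulr1 big1 ?addr0// => e' e'e.
by rewrite (inj_eq (@edge_inj _ _ _)) (negbTE e'e) mulr0.
Qed.

Lemma extension_out x i j : (i, j) \notin P -> extension x i j = 0.
Proof.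
move=> ijP; rewrite mxE big1// => e _; case: eqP => [eij|_]; last exact: mulr0.
by move: ijP; rewrite -eij [edge e]surjective_pairing edge_in.
Qed.

Lemma Cinf_extension : Cinf_on good_nbhd extension.
Proof.
have Gd := tilt_generators_derivable BB' open_good_nbhd
  base_generators_derivable (a := weight) (b := moment) (z := z).
apply: (Cinf_on_galg open_good_nbhd (Gd _ _ _ _)) => //.
- by move=> e; apply: galg_gen; left; left; exists e.
- by move=> l; apply: galg_gen; right; exists l.
- by move=> e x /(_ e)[Me _]; exact: powR_gt0.
- move=> i j; eexists; last by move=> x _; rewrite mxE.
  apply: galg_sum => e; apply: galg_mul; last exact: galg_cst.
  apply: galg_mul; apply: galg_gen; first by left; left; left; left; exists e.
  by left; right; exists e.
Qed.

(** At scalable marginals the extension has the required row and column sums and is a diagonal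
    scaling of the powered matrix, so Sinkhorn scaling converges to it. *)
Lemma extension_eq_sinkhorn_limit x : good_nbhd x ->
  pattern_mx P x.1.1 -> scalable_marginals P (x.1.2, x.2) ->
  extension x = sinkhorn_limit lambda x.
Proof.
move=> Ux [M_ge0 [M_P _]] [/= r0 [c0 [X [X_ge0 [X_P [X_row X_col]]]]]].
have XP i j : (i, j) \notin P -> X i j = 0.
  move=> ijP; apply/eqP; rewrite eq_le X_ge0 andbT leNgt.
  by apply: contra ijP => /X_P.
(* The scalability witness [X] and the extension have equal moments against [B], hence against
   [E = D *m B]; thus they share all marginals. *)
have momE s : \sum_e extension x (edge e).1 (edge e).2 * E s e =
    row_mx x.1.2 x.2 0 s.
  have /(incidence_moment _ _ XP) <- := conj X_row X_col.
  have sumE (Y : 'M[R]_(n, m)) : \sum_e Y (edge e).1 (edge e).2 * E s e =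
      \sum_l D s l * \sum_e Y (edge e).1 (edge e).2 * B l e.
    under [RHS]eq_bigr do rewrite mulr_sumr.
    rewrite exchange_big; apply: eq_bigr => e _ /=.
    by rewrite {1}EB mxE mulr_sumr; apply: eq_bigr => l _; rewrite mulrCA.
  rewrite !sumE; apply: eq_bigr => l _; congr (_ * _).
  rewrite (@moment_marginals X x)// -(zP _ Ux); apply: eq_bigr => e _.
  by rewrite extension_edge.
have [ext_row ext_col] := (incidence_moment _ _ (@extension_out x)).2 momE.
have ext_ge0 i j : 0 <= extension x i j.
  rewrite mxE; apply: sumr_ge0 => e _.
  by rewrite !mulr_ge0 ?powR_ge0 ?expR_ge0.
(* Since [z x *m B = w *m E], the exponent on an edge is the sum of the row and column coordinates
   of [w]; the factors [expR (- w)] undo the scaling. *)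
pose w := z x *m C.
apply/esym; apply: cvg_lim; first exact: norm_hausdorff.
apply: (@sinkhorn_iter_cvg _ _ _ _ _ _ ext_ge0 ext_row ext_col r0 c0 _
  (fun i => expR (- w 0 (lshift m i))) (fun j => expR (- w 0 (rshift n j)))).
- by move=> i; exact: expR_gt0.
- by move=> j; exact: expR_gt0.
move=> i j; rewrite mxE; have [ijP|ijP] := boolP ((i, j) \in P); last first.
  rewrite extension_out// !mul0r; case: eqP => // /eqP Mn0.
  by case/negP: ijP; apply/M_P; rewrite lt_def Mn0 M_ge0.
have [e eij] := edgeP ijP; rewrite gt_eqF; last exact/M_P.
have := extension_edge x e; rewrite eij /= => ->.
rewrite /weight /entry_at /tilt_factor eij /= {1}BE mulmxA mul_incidence eij /=.
by rewrite -!mulrA -!expRD (_ : _ + _ = 0) ?expR0 ?mulr1// -/w; ring.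
Qed.

End SmoothExtension.

Unset Implicit Arguments.

Theorem theorem1 (R : realType) (lambda : R) (n m : nat)
    (P : {set 'I_n.+1 * 'I_m.+1}) :
  0 < lambda ->
  smooth_on
    [set x : 'M[R]_(n.+1, m.+1) * 'rV[R]_n.+1 * 'rV[R]_m.+1 |
       pattern_mx P x.1.1 /\ scalable_marginals P (x.1.2, x.2)]
    (sinkhorn_limit lambda).
Proof.
move=> _ x0 [[_ [M_P _]] [_ [_ [X0 [X0_ge0 [X0_P [X0_row X0_col]]]]]]].
have X0_out i j : (i, j) \notin P -> X0 i j = 0.
  move=> ijP; apply/eqP; rewrite eq_le X0_ge0 andbT leNgt.
  by apply: contra ijP => /X0_P.
pose E := incidence R P.
have /submxP[C BE] : (row_base E <= E)%MS by rewrite eq_row_base.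
have /submxP[D EB] : (E <= row_base E)%MS by rewrite eq_row_base.
have /row_freeP[B' BB'] := row_base_free E.
have [z zP] := @exists_good_tilt R lambda _ _ _ C BE B' BB' x0 X0 X0_out X0_row X0_col.
exists (good_nbhd C B' x0 X0); split; first exact: open_good_nbhd.
(* At the base point the correction vanishes, so the witness is [X0] itself. *)
- move=> e; split; first by apply/M_P; exact: edge_in.
  rewrite /witness big1 ?addr0; first by apply/X0_P; exact: edge_in.
  by move=> l _; rewrite subrr mul0r.
- exists (extension lambda z); split; first exact: Cinf_extension zP.
  move=> y Uy [yM ymarg]; exact: (extension_eq_sinkhorn_limit BE EB zP).
Qed.
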